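(* Let $X$ be an $n$-premaniplex and let $\xi:\Pi(X)\to\Gamma$ be a voltage assignment such that the derived graph $X^\xi$ is a maniplex. Then $X^\xi$ is the flag graph of a polytope if and only if $$\xi(\Pi^{x,y}_{[0,m]}(X))\cap\xi(\Pi^{x,y}_{[k,n-1]}(X))=\xi(\Pi^{x,y}_{[k,m]}(X))$$ for all $k,m\in\{0,\dots,n-1\}$ and all vertices $x,y$ of $X$.
   Context: **Polytopes.** A poset is flagged if it has a least and a greatest element and all its maximal chains (flags) have the same finite cardinality, say $n+2$; it then has an order-preserving rank function onto $\{-1,0,\dots,n\}$. Two flags are $i$-adjacent if they differ exactly in their element of rank $i$. An (abstract) $n$-polytope is a flagged poset with rank function onto $\{-1,\dots,n\}$ such that (diamond condition) for each flag $\Phi$ and each $i\in\{0,\dots,n-1\}$ there is a unique flag that is $i$-adjacent to $\Phi$; and (strong flag connectedness) any two flags $\Phi,\Psi$ are joined by a sequence of flags, consecutive ones adjacent, all containing $\Phi\cap\Psi$. The flag graph of a polytope has the flags as vertices, with an edge of colour $i$ joining each pair of $i$-adjacent flags. An edge-coloured graph ''is the flag graph of a polytope'' if it is isomorphic, by a colour-preserving isomorphism, to the flag graph of some $n$-polytope. **Graphs.** Graphs may have parallel edges and semi-edges. Every edge consists of darts; a dart $d$ has an initial vertex, a terminal vertex and an inverse dart $d^{-1}$; an edge joining two different vertices (a link) consists of two mutually inverse darts, and a semi-edge consists of a single dart $d=d^{-1}$ with both ends at the same vertex. An $n$-premaniplex is a connected graph with edges coloured by $\{0,\dots,n-1\}$,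 all of whose edges are links or semi-edges, such that each vertex is incident to exactly one edge of each colour, and such that if $|i-j|>1$ every path of length $4$ alternating between colours $i$ and $j$ is closed. An $n$-maniplex is an $n$-regular connected simple graph (no semi-edges, no parallel edges) with a proper edge colouring with colours $\{0,\dots,n-1\}$ such that if $|i-j|>1$ the subgraph formed by edges of colours $i,j$ is a disjoint union of $4$-cycles. **Voltages.** A voltage assignment $\xi:\Pi(X)\to\Gamma$ into a group $\Gamma$ is a groupoid antimorphism from the fundamental groupoid of $X$; equivalently, it assigns to each dart $d$ an element $\xi(d)\in\Gamma$ with $\xi(d^{-1})=\xi(d)^{-1}$ and is extended to paths by $\xi(d_1d_2\cdots d_k)=\xi(d_k)\cdots\xi(d_1)$ (empty paths have trivial voltage). The derived graph $X^\xi$ has vertex set $V\times\Gamma$ and dart set $D\times\Gamma$ ($V$, $D$ the vertices and darts of $X$); the dart $(d,g)$, where $d$ goes from $x$ to $y$, goes from $(x,g)$ to $(y,\xi(d)g)$, has inverse $(d^{-1},\xi(d)g)$ and has the colour of $d$. For vertices $x,y$ and a set of colours $I$, $\Pi_I^{x,y}(X)$ is the set of (homotopy classes of) paths from $x$ to $y$ using only darts with colours in $I$, and $\xi(\Pi_I^{x,y}(X))\subset\Gamma$ is the set of voltages of all such paths. $[a,b]$ denotes $\{a,a+1,\dots,b\}$, which is empty if $a>b$; thus $\Pi_\emptyset^{x,y}(X)$ contains only the empty path if $x=y$ and is empty if $x\ne y$. *)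

(* Defs.v *)
From mathcomp Require Import all_boot all_order all_algebra.
From mathcomp Require Import all_classical.

Set Implicit Arguments.
Unset Strict Implicit.
Unset Printing Implicit Defensive.

Import Order.TTheory.
Local Open Scope classical_set_scope.
Local Open Scope card_scope.

(** * Edge-coloured graphs made of darts *)

(* An edge is an orbit {d, inv d}; the two darts of an edge have the same
   colour. Nothing here forces an edge to be a link or a semi-edge. *)
Record cgraph (n : nat) := CGraph {
  vertex :> Type;
  dart : Type;
  ini : dart -> vertex;
  ter : dart -> vertex;
  inv : dart -> dart;
  colour : dart -> 'I_n;
  invK : involutive inv;
  ini_inv : forall d, ini (inv d) = ter d;
  colour_inv : forall d, colour (inv d) = colour d
}.

Section Graphs.
Variables (n : nat) (X : cgraph n).

Fixpoint is_path (I : set 'I_n) (x : X) (p : seq (dart X)) (y : X) : Prop :=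
  if p is d :: q then [/\ ini d = x, I (colour d) & is_path I (ter d) q y]
  else x = y.

Definition connected_graph : Prop :=
  inhabited X /\ forall x y : X, exists p, is_path setT x p y.

Definition is_link (d : dart X) : Prop := ini d <> ter d.

Definition is_semiedge (d : dart X) : Prop := inv d = d.

End Graphs.

(* |i - j| > 1 *)
Definition far n (i j : 'I_n) : bool := (i.+1 < j)%N || (j.+1 < i)%N.

(* As every edge is a link or a semi-edge, the edges incident to x correspond
   to the darts starting at x. *)
Definition premaniplex n (X : cgraph n) : Prop :=
  [/\ connected_graph X,
      forall d : dart X, is_link d \/ is_semiedge d,
      forall (x : X) (c : 'I_n), exists! d : dart X, ini d = x /\ colour d = c
    & forall (i j : 'I_n) (x y : X) (p : seq (dart X)), far i j ->
        is_path setT x p y -> map (@colour n X) p = [:: i; j; i; j] -> x = y].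

Section Maniplexes.
Variables (n : nat) (X : cgraph n).

Definition simple_graph : Prop :=
  (forall d : dart X, is_link d) /\
  (forall d e : dart X, ini d = ini e -> ter d = ter e -> d = e).

Definition regular_graph (k : nat) : Prop :=
  forall x : X, [set d : dart X | ini d = x] #= `I_k.

Definition proper_colouring : Prop :=
  forall d e : dart X, ini d = ini e -> colour d = colour e -> d = e.

Definition adj2 (i j : 'I_n) (x y : X) : Prop :=
  exists d : dart X,
    [/\ ini d = x, ter d = y & colour d = i \/ colour d = j].

(* Every vertex lies on a 4-cycle C which is a full connected component of the
   subgraph of colours i, j: the neighbours of each C a are exactly its
   successor and its predecessor on C. *)
Definition disjoint_4cycles (i j : 'I_n) : Prop :=
  forall x : X, exists C : 'I_4 -> X,
    [/\ injective C, exists a, C a = x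
      & forall a y, adj2 i j (C a) y <-> y = C (ordS a) \/ y = C (ord_pred a)].

Definition maniplex : Prop :=
  [/\ connected_graph X, simple_graph, regular_graph n, proper_colouring
    & forall i j : 'I_n, far i j -> disjoint_4cycles i j].

End Maniplexes.

Definition cgraph_iso n (X Y : cgraph n) : Prop :=
  exists (f : X -> Y) (h : dart X -> dart Y),
    [/\ bijective f, bijective h,
        forall d, ini (h d) = f (ini d) /\ ter (h d) = f (ter d),
        forall d, h (inv d) = inv (h d)
      & forall d, colour (h d) = colour d].

(** * Voltages *)

Record voltage n (X : cgraph n) (G : groupType) := Voltage {
  volt :> dart X -> G;
  volt_inv : forall d, volt (inv d) = ((volt d)^-1)%g
}.

Section Voltages.
Variables (n : nat) (X : cgraph n) (G : groupType) (xi : voltage X G).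

(* xi (d_1 d_2 ... d_k) = xi d_k * ... * xi d_1 *)
Fixpoint path_volt (p : seq (dart X)) : G :=
  if p is d :: q then (path_volt q * xi d)%g else 1%g.

(* xi (Pi_I^{x,y}(X)); path_volt is invariant under homotopy, so ranging over
   paths or over their homotopy classes gives the same set. *)
Definition path_volts (I : set 'I_n) (x y : X) : set G :=
  [set g | exists2 p, is_path I x p y & path_volt p = g].

Lemma derived_invK :
  involutive (fun e : dart X * G => (inv e.1, xi e.1 * e.2)%g).
Proof. by case=> d g /=; rewrite invK volt_inv mulgA mulVg mul1g. Qed.

Definition derived : cgraph n :=
  @CGraph n (X * G)%type (dart X * G)%type
    (fun e => (ini e.1, e.2))
    (fun e => (ter e.1, (xi e.1 * e.2)%g))
    (fun e => (inv e.1, (xi e.1 * e.2)%g))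
    (fun e => colour e.1)
    derived_invK
    (fun e => congr1 (fun x => (x, (xi e.1 * e.2)%g)) (ini_inv e.1))
    (fun e => colour_inv e.1).

End Voltages.

(* [a, b], empty when b < a *)
Definition colours n (a b : nat) : set 'I_n := [set c : 'I_n | (a <= c <= b)%N].

(** * Abstract polytopes *)

Section Posets.
Variables (disp : Order.disp_t) (P : porderType disp).
Local Open Scope order_scope.

Definition is_chain (F : set P) : Prop := total_on F (fun x y => x <= y).

Definition is_flag (F : set P) : Prop :=
  is_chain F /\ forall H : set P, is_chain H -> F `<=` H -> H = F.

Definition flags : Type := {F : set P | is_flag F}.

Definition flagged (n : nat) : Prop :=
  [/\ exists b : P, forall x, b <= x,
      exists t : P, forall x, x <= t
    & forall F : set P, is_flag F -> F #= `I_n.+2].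

(* In a flagged poset, all of whose flags have n + 2 elements, there is exactly
   one such function. *)
Definition rank_function (n : nat) (rk : P -> int) : Prop :=
  {homo rk : x y / x < y >-> (x < y)%R} /\
  range rk = [set r : int | (- 1 <= r <= Posz n)%R].

Variables (n : nat) (rk : P -> int).

Definition adjacent (i : 'I_n) (F H : flags) : Prop :=
  forall x y, sval F x -> sval H y -> rk x = rk y ->
    (x <> y <-> rk x = Posz i).

Definition diamond_condition : Prop :=
  forall (F : flags) (i : 'I_n), exists! H : flags, adjacent i F H.

Definition strongly_flag_connected : Prop :=
  forall F H : flags, exists (k : nat) (s : nat -> flags),
    [/\ s 0 = F, s k = H,
        forall l, (l < k)%N -> exists i : 'I_n, adjacent i (s l) (s l.+1)
      & forall l, (l <= k)%N -> sval F `&` sval H `<=` sval (s l)].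

End Posets.

Record polytope (n : nat) := Polytope {
  pdisp : Order.disp_t;
  pposet :> porderType pdisp;
  prank : pposet -> int;
  pflagged : flagged pposet n;
  prankP : rank_function n prank;
  pdiamond : diamond_condition n prank;
  pconnected : strongly_flag_connected n prank
}.

Section FlagGraph.
Variables (n : nat) (P : polytope n).

Lemma adjacent_sym (i : 'I_n) (F H : flags P) :
  adjacent (@prank n P) i F H -> adjacent (@prank n P) i H F.
Proof.
move=> adjFH x y Hx Fy rxy; have [ne_r r_ne] := adjFH y x Fy Hx (esym rxy).
by split=> [/nesym/ne_r <- //| rx]; apply/nesym/r_ne; rewrite -rxy.
Qed.

Record flag_dart := FlagDart {
  fd_colour : 'I_n;
  fd_ini : flags P;
  fd_ter : flags P;
  fd_adj : adjacent (@prank n P) fd_colour fd_ini fd_ter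
}.

Definition flag_dart_inv (d : flag_dart) : flag_dart :=
  FlagDart (adjacent_sym (@fd_adj d)).

Lemma flag_dart_invK : involutive flag_dart_inv.
Proof.
by case=> i F H adj; rewrite /flag_dart_inv /=; congr FlagDart;
  exact: Prop_irrelevance.
Qed.

Definition flag_graph : cgraph n :=
  @CGraph n (flags P) flag_dart fd_ini fd_ter flag_dart_inv fd_colour
    flag_dart_invK (fun=> erefl) (fun=> erefl).

End FlagGraph.

Definition is_flag_graph_of_polytope n (X : cgraph n) : Prop :=
  exists P : polytope n, cgraph_iso X (flag_graph P).

(* Main.v *)
Require Import Defs.
From HB Require Import structures.
From mathcomp Require Import all_boot all_order all_algebra.
From mathcomp Require Import all_classical.
From mathcomp Require Import zify.

Set Implicit Arguments.
Unset Strict Implicit.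
Unset Printing Implicit Defensive.

Import Order.TTheory GRing.Theory.
Local Open Scope classical_set_scope.

(** The path of X with voltage g from x to y lifts to a path of the derived graph
   from (x, h) to (y, g h), so the condition on voltages says that two vertices
   of X^xi joined by a path with colours in [0, m] and by a path with colours in
   [k, n - 1] are joined by a path with colours in [k, m].

   In a flag graph, the ends of two such paths share all their elements of rank
   outside [k, m]; strong flag connectedness joins them by flags that contain
   these elements, hence by adjacencies of colours in [k, m].

   Conversely, the faces of rank i of a maniplex are the components left after
   deleting the edges of colour i, ordered by rank and nonempty intersection.
   Since distant colours commute, a path avoiding colour i can be rearranged so
   that all its colours below i come first; this makes the order transitive and
   gives every chain a common vertex, so the maximal chains are the sets of faces
   through a vertex. The path intersection property then turns a family of paths
   from u to v, one avoiding each colour of a set J, into a single path that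
   avoids J. With all colours in J this says that a vertex is determined by its
   faces; with J the ranks of the common faces it is strong connectedness. *)

(** * Preliminaries on finite sets and the 4-cycle *)

(** A missed point of [B] together with the image of [A] would form [m + 1] points of [B]. *)
Lemma inj_card_surj (T U : Type) (f : T -> U) (A : set T) (B : set U) (m : nat) :
  (A #= `I_m)%card -> (B #= `I_m)%card -> {in A &, injective f} ->
  f @` A `<=` B -> B `<=` f @` A.
Proof.
move=> cA cB fI sAB b Bb; apply: contrapT => nb.
have cfA : (f @` A #= `I_m)%card := card_eq_trans (inj_card_eq fI) cA.
have cbfA : (b |` f @` A #= `I_m.+1)%card.
  by apply/eq_cardSP; exists b; [left|rewrite setUC setUDK// => _ [-> fAb]].
have : (b |` f @` A #<= B)%card by apply: subset_card_le => c [->//|/sAB].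
by rewrite (card_le_eql cbfA) (card_le_eqr cB) card_le_II ltnn.
Qed.

Lemma bijective_inj_surj (T U : Type) (f : T -> U) :
  injective f -> (forall y, exists x, f x = y) -> bijective f.
Proof.
move=> fI fS; rewrite -setTT_bijective; split=> // [x y _ _|y _]; first exact: fI.
by have [x <-] := fS y; exists x.
Qed.

Lemma ord4_opposite (a b c : 'I_4) :
  b = ordS a \/ b = ord_pred a -> c = ordS b \/ c = ord_pred b -> c <> a ->
  c = ordS (ordS a).
Proof.
have PP (e : 'I_4) : ord_pred (ord_pred e) = ordS (ordS e).
  by apply: val_inj; case: e => [[|[|[|[|]]]] ?].
by case=> -> [] ->; rewrite ?PP // ?ordSK ?ord_predK.
Qed.

(** * Reachability within a set of colours *)

Section Reach.
Variables (n : nat) (X : cgraph n).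
Implicit Types (I J : set 'I_n) (x y z : X) (d : dart X).

Definition reach I x y : Prop := exists p, is_path I x p y.

Lemma ter_inv d : ter (Defs.inv d) = ini d.
Proof. by rewrite -ini_inv Defs.invK. Qed.

Lemma is_path_cat I x y z (p q : seq (dart X)) :
  is_path I x p y -> is_path I y q z -> is_path I x (p ++ q) z.
Proof.
elim: p x => [|d p IHp] x /=; first by move=> ->.
by case=> dx Id py qz; split=> //; apply: IHp py qz.
Qed.

Lemma reach_refl I x : reach I x x.
Proof. by exists [::]. Qed.

Lemma reach_trans I x y z : reach I x y -> reach I y z -> reach I x z.
Proof. by case=> p px [q qy]; exists (p ++ q); apply: is_path_cat qy. Qed.

Lemma reach_dart I d : I (colour d) -> reach I (ini d) (ter d).
Proof. by exists [:: d]. Qed.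

Lemma reach_ind I (P : X -> X -> Prop) :
    (forall x, P x x) ->
    (forall d y, I (colour d) -> P (ter d) y -> P (ini d) y) ->
  forall x y, reach I x y -> P x y.
Proof.
move=> P0 PS x y [p]; elim: p x => [|d p IHp] x /=; first by move=> ->.
case=> <- Id py; apply: PS => //; exact: IHp.
Qed.

Lemma reach_sym I x y : reach I x y -> reach I y x.
Proof.
elim/reach_ind=> [z|d z Id IH]; first exact: reach_refl.
apply: reach_trans IH _.
by rewrite -[ini d]ter_inv -(ini_inv d); apply: reach_dart; rewrite colour_inv.
Qed.

Lemma reach_sub I J x y : I `<=` J -> reach I x y -> reach J x y.
Proof.
move=> sIJ; elim/reach_ind=> [z|d z Id]; first exact: reach_refl.
by apply: reach_trans; apply: reach_dart; apply: sIJ.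
Qed.

Lemma reach_set0 x y : reach set0 x y -> x = y.
Proof. by elim/reach_ind. Qed.

Definition path_intersection : Prop := forall (k m : 'I_n) x y,
  reach (colours 0 m) x y -> reach (colours k n.-1) x y ->
  reach (colours k m) x y.

End Reach.

(** * Lifting paths to the derived graph *)

Section Derived.
Variables (n : nat) (X : cgraph n) (G : groupType) (xi : voltage X G).

Lemma path_volts_reach (I : set 'I_n) (x y : X) (g h : G) :
  path_volts xi I x y g <-> reach (X := derived xi) I (x, h) (y, g * h)%g.
Proof.
split.
  case=> p; elim: p x g h => [|d p IHp] x g h /=.
    by move=> -> <-; rewrite mul1g; apply: reach_refl.
  case=> <- Id py <-.
  have /= hd := @reach_dart _ (derived xi) I (d, h) Id.
  by apply: reach_trans hd _; rewrite -mulgA; apply: IHp py _.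
case=> p; elim: p x h g => [|[d a] p IHp] x h g /=.
  by case=> -> gh; exists [::] => //=; apply: (mulIg h); rewrite mul1g.
case=> -[<- ->] Id.
(* The rest of the path starts at height [xi d * h], so its voltage has to be [g * (xi d)^-1]. *)
have -> : (g * h = g * (xi d)^-1 * (xi d * h))%g by rewrite mulgA mulgVK.
by move=> /IHp [q qy qg]; exists (d :: q) => //=; rewrite qg mulgVK.
Qed.

Lemma path_volts_intersection :
  (forall (k m : 'I_n) (x y : X),
     path_volts xi (colours 0 m) x y `&` path_volts xi (colours k n.-1) x y
     = path_volts xi (colours k m) x y) <->
  path_intersection (derived xi).
Proof.
split=> [H k m [x h] [y g]|H k m x y].
  have -> : g = (g * h^-1 * h)%g by rewrite mulgVK.
  by rewrite -!path_volts_reach -H.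
apply/seteqP; split=> g; last first.
  move=> /(path_volts_reach _ _ _ _ 1%g) Hg.
  split; apply/(path_volts_reach _ _ _ _ 1%g); apply: reach_sub Hg => c;
    rewrite /colours /=; have := ltn_ord c; lia.
by case=> /(path_volts_reach _ _ _ _ 1%g) H1 /(path_volts_reach _ _ _ _ 1%g) H2;
  apply/(path_volts_reach _ _ _ _ 1%g); apply: H.
Qed.
End Derived.

(** * Invariance under isomorphism *)

Section Isomorphism.
Variables (n : nat) (X Y : cgraph n).

Lemma path_intersection_iso :
  cgraph_iso X Y -> path_intersection Y -> path_intersection X.
Proof.
case=> f [h [[f' fK f'K] [h' hK h'K] fh hinv hc]] HY k m.
have fE I x y : reach I x y <-> reach I (f x) (f y).
  split.
    elim/reach_ind=> [z|d z Id]; first exact: reach_refl.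
    have [<- <-] := fh d; apply: reach_trans; apply: reach_dart; rewrite hc //.
  move=> H; rewrite -[x]fK -[y]fK; move: (f x) (f y) H => u v.
  elim/reach_ind=> [z|d z Id]; first exact: reach_refl.
  rewrite -(h'K d); have [-> ->] := fh (h' d); rewrite !fK.
  by apply: reach_trans; apply: reach_dart; rewrite -hc h'K.
by move=> x y; rewrite !fE; apply: HY.
Qed.
End Isomorphism.

(** * Flag graphs of polytopes *)

Lemma flag_dart_eq (n : nat) (P : polytope n) (d e : flag_dart P) :
  fd_colour d = fd_colour e -> fd_ini d = fd_ini e -> fd_ter d = fd_ter e -> d = e.
Proof.
case: d e => [i F H FH] [j F' H' FH'] /= ij FF HH; subst.
by congr FlagDart; apply: Prop_irrelevance.
Qed.

Section PolytopeFlags.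
Variables (n : nat) (P : polytope n).
Local Notation rk := (@prank n P).
Implicit Types F H : flags P.

Lemma flag_rank_inj F x y : sval F x -> sval F y -> rk x = rk y -> x = y.
Proof.
move=> Fx Fy rxy; have [rlt _] := prankP P.
case: F Fx Fy => F [chF _] /= Fx Fy.
have [] := chF x y Fx Fy; rewrite le_eqVlt => /orP[/eqP // | /rlt];
  by rewrite rxy ltxx.
Qed.

(** The [n + 2] elements of a flag have distinct ranks, and only [n + 2] ranks exist. *)
Lemma flag_rank_ex F (r : int) :
  (- 1 <= r <= n%:Z)%R -> exists2 x, sval F x & rk x = r.
Proof.
move=> rn; have [rlt rr] := prankP P; have [_ _ cF] := pflagged P.
suff /(_ r rn) [x Fx <-] : [set r : int | (- 1 <= r <= n%:Z)%R] `<=` rk @` sval F.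
  by exists x.
apply: (@inj_card_surj _ _ _ _ _ n.+2).
- by apply: cF; apply: svalP.
- have -> : [set r : int | (- 1 <= r <= n%:Z)%R] = (fun i : nat => i%:Z - 1)%R @` `I_n.+2.
    apply/seteqP; split=> [s /= sn|s /= [i ? <-]]; last lia.
    by exists (absz (s + 1)%R) => /=; lia.
  by apply: inj_card_eq => i j _ _ /addIr [].
- by move=> x y /set_mem Fx /set_mem Fy; apply: flag_rank_inj Fx Fy.
- by move=> _ [x _ <-]; rewrite -rr; exists x.
Qed.

(** A step of colour [c] replaces only the element of rank [c]. *)
Lemma reach_flags_common (I : set 'I_n) F H x :
  reach (X := flag_graph P) I F H ->
  sval F x -> (forall c : 'I_n, I c -> rk x <> c) -> sval H x.
Proof.
move=> + + xI; elim/reach_ind=> // -[i F1 F2 adj] K /= Ii IH F1x; apply: IH.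
have [y F2y ryx] : exists2 y, sval F2 y & rk y = rk x.
  apply: flag_rank_ex; have [_ rr] := prankP P.
  by suff : [set r : int | (- 1 <= r <= n%:Z)%R] (rk x) by []; rewrite -rr; exists x.
have [xy _] := adj x y F1x F2y (esym ryx).
have [-> //|/eqP/xy rxi] := eqVneq x y.
by case: (xI i Ii).
Qed.

Lemma flag_graph_path_intersection : path_intersection (flag_graph P).
Proof.
move=> k m F H FHm FHk.
have [N [s [s0 sN adj FHs]]] := @pconnected n P F H.
suff: forall l, (l <= N)%N -> reach (X := flag_graph P) (colours k m) F (s l).
  by move=> /(_ N (leqnn N)); rewrite sN.
elim=> [|l IHl] lN; first by rewrite s0; apply: reach_refl.
apply: reach_trans (IHl (ltnW lN)) _.
have [i adji] := adj l lN.
apply: (@reach_dart _ (flag_graph P) _ (FlagDart adji)) => /=.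
(* Otherwise one of the two paths avoids [i], so [H] and then every [s l] contains the element of
   [F] of rank [i], which an [i]-adjacency must change. *)
apply: contrapT => ikm.
have [x Fx rx] : exists2 x, sval F x & rk x = i.
  by apply: flag_rank_ex; have := ltn_ord i; lia.
have Hx : sval H x.
  have [mi|im] := ltnP m i.
    by apply: reach_flags_common FHm Fx _ => c; rewrite rx /colours /=; lia.
  apply: reach_flags_common FHk Fx _ => c; move: ikm; rewrite rx /colours /=; lia.
have sx l' : (l' <= N)%N -> sval (s l') x by move=> l'N; apply: FHs.
by have [_ /(_ rx)] := adji x x (sx l (ltnW lN)) (sx l.+1 lN) erefl.
Qed.
End PolytopeFlags.

(** * The face poset of a maniplex *)

Section Maniplex.
Variables (n : nat) (Y : cgraph n) (hM : maniplex Y).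
Implicit Types (u v w : Y) (d e : dart Y) (c : 'I_n).

(** * Commuting distant colours *)

Lemma dart_of_colour u c : exists2 d, ini d = u & colour d = c.
Proof.
have [_ _ regY propY _] := hM.
suff /(_ c I) [d] : [set: 'I_n] `<=` @colour n Y @` [set d | ini d = u].
  by exists d.
apply: (@inj_card_surj _ _ _ _ _ n) => //.
- by rewrite card_eq_sym card_II.
- by move=> d e /set_mem /= du /set_mem /= eu; apply: propY; rewrite du eu.
Qed.

(** From [ini d], the two colours in either order lead to the opposite vertex of the 4-cycle. *)
Lemma far_square d e : far (colour d) (colour e) -> ter d = ini e ->
  exists e' d', [/\ ini e' = ini d, ter e' = ini d', ter d' = ter e,
                    colour e' = colour e & colour d' = colour d].
Proof.
have [_ [_ parallel] _ _ cyc] := hM => fde de.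
have [C [_ [a Ca] CP]] := cyc _ _ fde (ini d).
have opp d1 d2 : far (colour d1) (colour d2) -> ini d1 = ini d -> ter d1 = ini d2 ->
    (colour d1 = colour d \/ colour d1 = colour e) ->
    (colour d2 = colour d \/ colour d2 = colour e) ->
    ter d2 = C (ordS (ordS a)).
  move=> f12 i1 t12 c1 c2.
  have [b Cb ba] : exists2 b, C b = ter d1 & b = ordS a \/ b = ord_pred a.
    have /CP[->|->] : adj2 (colour d) (colour e) (C a) (ter d1) by exists d1; rewrite Ca.
      by exists (ordS a) => //; left.
    by exists (ord_pred a) => //; right.
  have [c Cc cb] : exists2 c, C c = ter d2 & c = ordS b \/ c = ord_pred b.
    have /CP[->|->] : adj2 (colour d) (colour e) (C b) (ter d2) by exists d2; rewrite Cb.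
      by exists (ordS b) => //; left.
    by exists (ord_pred b) => //; right.
  rewrite -Cc; congr C; apply: ord4_opposite ba cb _ => ca.
  (* Turning back would reuse the edge of [d1], giving both darts the same colour. *)
  have d2E : d2 = Defs.inv d1.
    by apply: parallel; rewrite ?ini_inv ?ter_inv // -Cc ca Ca i1.
  by move: f12; rewrite d2E colour_inv /far; lia.
have [e' ie' ce'] := dart_of_colour (ini d) (colour e).
have [d' id' cd'] := dart_of_colour (ter e') (colour d).
exists e', d'; split=> //.
rewrite (opp e' d') ?(opp d e) ?ce' ?cd' //; [by left|by right| |by right|by left].
by move: fde; rewrite /far; lia.
Qed.

(** The argument is a face index, one more than the rank; hence the shift. *)
Definition avoid (j : nat) : set 'I_n := [set c | c.+1 <> j].
Definition below (j : nat) : set 'I_n := [set c | (c.+1 < j)%N].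
Definition above (j : nat) : set 'I_n := [set c | (j < c.+1)%N].

(* A step of colour above [j] commutes with every step of colour below [j],
   so the small colours can be moved to the front. *)
Lemma reach_split j u v : reach (avoid j) u v ->
  exists2 w, reach (below j) u w & reach (above j) w v.
Proof.
have swap u' w : reach (below j) u' w -> forall d, ter d = u' -> above j (colour d) ->
    exists e, [/\ reach (below j) (ini d) (ini e), ter e = w & colour e = colour d].
  elim/reach_ind=> [z|e z le IH] d dt cd.
    by exists d; split=> //; apply: reach_refl.
  have fde : far (colour d) (colour e).
    by move: cd le; rewrite /above /below /far /=; lia.
  have [e' [d' [ie' te' td' ce' cd']]] := far_square fde dt.
  rewrite -cd' in cd *.
  have [f [rf tf cf]] := IH d' td' cd.
  exists f; split=> //; apply: reach_trans rf.
  by rewrite -ie' -te'; apply: reach_dart; rewrite ce'.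
elim/reach_ind=> [z|d z cd [w uw wv]].
  by exists z; apply: reach_refl.
have [lt_cj|gt_cj|//] := ltngtP (colour d).+1 j.
  by exists w => //; apply: reach_trans uw; apply: reach_dart.
have [e [re te ce]] := swap _ _ uw d erefl gt_cj.
exists (ini e) => //; apply: reach_trans wv; rewrite -te.
by apply: reach_dart; rewrite ce.
Qed.

(** The colours above [j] come first, so [w] shares with [u] the faces of index at most [j] and with
    [v] those of index at least [j]. *)
Lemma reach_between j u v : reach (avoid j) u v -> exists w,
  (forall i, (i <= j)%N -> reach (avoid i) u w) /\
  (forall i, (j <= i)%N -> reach (avoid i) w v).
Proof.
move=> /reach_sym /reach_split [w vw wu]; exists w.
split=> i ij; apply: reach_sym; [move: wu|move: vw]; apply: reach_sub => c;
  rewrite /above /below /avoid /=; lia.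
Qed.

(** * Consequences of path intersection *)

Hypothesis hP : path_intersection Y.

(** Path intersection with a strict upper bound; for [k = 0] no colour remains and [u = v]. *)
Lemma reach_lt_ge (k : 'I_n) (a : nat) u v : (a <= k)%N ->
  reach [set c : 'I_n | (c < k)%N] u v -> reach [set c : 'I_n | (a <= c)%N] u v ->
  reach [set c : 'I_n | (a <= c < k)%N] u v.
Proof.
case: k => [[|k] kn] ak rlt rge.
  by have <- := reach_set0 (reach_sub (fun c => notF) rlt); apply: reach_refl.
have kn' : (k < n)%N by lia.
have an : (a < n)%N := leq_ltn_trans ak kn.
have := @hP (Ordinal an) (Ordinal kn') u v; rewrite /colours /= => H.
apply: (@reach_sub _ _ [set c : 'I_n | (a <= c <= k)%N]).
  by move=> c /=; rewrite ltnS.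
apply: H; first exact: reach_sub rlt.
by apply: reach_sub rge => c /= ->; have := ltn_ord c; lia.
Qed.

(* The colours outside [I] are removed from the path in increasing order:
   [reach_split] moves the colours below the removed one to the front, and the
   path intersection property makes this front part avoid the colours already
   removed. *)
Lemma reach_bigcap (I : set 'I_n) u v :
  (forall k : 'I_n, ~ I k -> reach (avoid k.+1) u v) -> reach I u v.
Proof.
move=> H.
(* In this invariant [a] is [0] or one more than the last colour removed below [t]. *)
suff : forall t, (t <= n)%N -> exists w (a : nat),
    [/\ (a <= t)%N, (forall c : 'I_n, (a <= c < t)%N -> I c),
        reach I u w & reach [set c : 'I_n | (a <= c)%N] w v].
  move=> /(_ n (leqnn n)) [w [a [an aI uw wv]]].
  apply: reach_trans uw _; apply: reach_sub wv => c /= ac.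
  by apply: aI; rewrite ac ltn_ord.
elim=> [_|t IHt tn].
  exists u, 0; split=> //; first exact: reach_refl.
  have [[_ conn] _ _ _ _] := hM.
  by have := conn u v; apply: reach_sub => c.
have [w [a [at_ aI uw wv]]] := IHt (ltnW tn).
have [It|nIt] := pselect (I (Ordinal tn)).
  exists w, a; split=> // [|c]; first exact: leqW.
  rewrite ltnS (leq_eqVlt c) => /andP[ac /predU1P[ct|ct]]; last by apply: aI; rewrite ac.
  by have <- : Ordinal tn = c by apply: val_inj.
(* The part from [u] to [w] stays in [I], so it avoids [t] as well. *)
have : reach (avoid t.+1) w v.
  apply: reach_trans (H _ nIt); apply: reach_sym; apply: reach_sub uw => c Ic [ct].
  by apply: nIt; have -> : Ordinal tn = c by apply: val_inj.
move=> /reach_split [w' ww' w'v].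
exists w', t.+1; split=> // [c|]; first by lia.
  apply: reach_trans uw _.
  suff : reach [set c : 'I_n | (a <= c < Ordinal tn)%N] w w'.
    by apply: reach_sub => c /= /aI.
  apply: reach_lt_ge => //.
  (* Via [v], [w'] is reached by colours at least [a], since those from [w'] to [v] exceed [t]. *)
  apply: (reach_trans wv); apply: reach_sym; apply: reach_sub w'v => c.
  by rewrite /above /=; lia.
Qed.

(** * Faces as components, ordered by incidence *)

Lemma reach_eq (I : set 'I_n) u v : reach I u v -> reach I u = reach I v.
Proof.
move=> uv; apply/seteqP; split=> w; last exact: reach_trans uv.
exact: reach_trans (reach_sym uv).
Qed.

(** Consecutive darts of one colour cancel by properness. *)
Lemma reach_set1 c u v : reach [set c] u v ->
  u = v \/ exists d, [/\ ini d = u, ter d = v & colour d = c].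
Proof.
have [_ _ _ propY _] := hM.
elim/reach_ind=> [z|d z dc [<-|[e [ie te ec]]]]; first by left.
  by right; exists d.
left; rewrite -te (_ : e = Defs.inv d) ?ter_inv //.
by apply: propY; rewrite ?ini_inv ?colour_inv // ec.
Qed.

(* The index of a face is its rank plus one; as no colour is excluded for the
   indices [0] and [n.+1], these give the least and the greatest face. *)
Record face := Face {
  face_idx : 'I_n.+2;
  face_set : set Y;
  face_setP : exists u, face_set = reach (avoid face_idx) u
}.

Definition face_at (i : 'I_n.+2) u : face :=
  @Face i (reach (avoid i) u) (ex_intro _ u erefl).

Lemma face_at_eq (F : face) u : face_set F u -> F = face_at (face_idx F) u.
Proof.
case: F => i S /= SP Su; have SE : S = reach (avoid i) u.
  by have [w Sw] := SP; rewrite Sw in Su *; apply: reach_eq.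
by subst S; congr Face; apply: Prop_irrelevance.
Qed.

Lemma face_eq (F G : face) u :
  face_idx F = face_idx G -> face_set F u -> face_set G u -> F = G.
Proof. by move=> FG /face_at_eq -> /face_at_eq ->; rewrite FG. Qed.

Lemma face_reach (F : face) u v :
  face_set F u -> face_set F v <-> reach (avoid (face_idx F)) u v.
Proof. by move=> /face_at_eq ->. Qed.

(* The order on faces is transitive only in a maniplex, hence the parameter. *)
Definition faces of maniplex Y : Type := face.
Local Notation facesM := (faces hM).
Implicit Types (F : facesM) (K : set facesM).

HB.instance Definition _ := gen_eqMixin facesM.
HB.instance Definition _ := gen_choiceMixin facesM.

Definition face_le (F1 F2 : facesM) : bool :=
  `[< (face_idx F1 <= face_idx F2)%N /\ face_set F1 `&` face_set F2 !=set0 >].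

Fact face_le_refl : reflexive face_le.
Proof.
move=> F; apply/asboolP; split=> //; have [u Fu] := face_setP F.
by exists u; rewrite Fu; split; apply: reach_refl.
Qed.

Fact face_le_anti : antisymmetric face_le.
Proof.
move=> F1 F2 /andP[/asboolP[le12 [u [u1 u2]]] /asboolP[le21 _]].
by apply: face_eq u1 u2; apply/val_inj/eqP; rewrite eqn_leq le12.
Qed.

Fact face_le_trans : transitive face_le.
Proof.
move=> F2 F1 F3 /asboolP[le12 [u [u1 u2]]] /asboolP[le23 [v [v2 v3]]].
apply/asboolP; split; first exact: leq_trans le23.
(* [u] and [v] lie in the middle face; the vertex between them stays in both outer faces. *)
have [w [uw wv]] := reach_between ((face_reach v u2).1 v2).
exists w; split; first by apply/(face_reach w u1)/uw.
by apply/(face_reach w v3)/reach_sym/wv.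
Qed.

HB.instance Definition _ := Order.Le_isPOrder.Build Order.default_display
  facesM face_le_refl face_le_anti face_le_trans.

Lemma face_leP F1 F2 : reflect
  ((face_idx F1 <= face_idx F2)%N /\ face_set F1 `&` face_set F2 !=set0)
  (F1 <= F2)%O.
Proof. exact: asboolP. Qed.

(** * Flags as the sets of faces through a vertex *)

Definition flag_of u : set facesM := [set F | face_set F u].

Lemma flag_of_at u i : flag_of u (face_at i u).
Proof. exact: reach_refl. Qed.

Lemma chain_idx_eq K F1 F2 : is_chain K -> K F1 -> K F2 ->
  face_idx F1 = face_idx F2 -> F1 = F2.
Proof.
move=> chK K1 K2 e12.
have [/face_leP[_ [v [v1 v2]]]|/face_leP[_ [v [v2 v1]]]] := chK F1 F2 K1 K2;
  exact: face_eq v1 v2.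
Qed.

(** It has a face of every index, and a chain has at most one of each. *)
Lemma is_flag_flag_of u : is_flag (flag_of u).
Proof.
split=> [F1 F2 u1 u2|K chK uK].
  have [le12|le21] := leqP (face_idx F1) (face_idx F2).
    by left; apply/face_leP; split=> //; exists u.
  by right; apply/face_leP; split; [exact: ltnW|exists u].
apply/seteqP; split=> // F KF; rewrite /flag_of /=.
rewrite (chain_idx_eq chK KF (uK _ (flag_of_at u (face_idx F)))) //.
exact: flag_of_at.
Qed.

Lemma chain_sub_flag_of K : is_chain K -> exists u, K `<=` flag_of u.
Proof.
move=> chK.
have step (r : nat) F : K F -> (r <= face_idx F)%N -> exists2 u, face_set F u &
    forall F', K F' -> (face_idx F' < r)%N -> face_set F' u.
  elim: r F => [|r IHr] F KF rF.
    by have [u Fu] := face_setP F; exists u => //; rewrite Fu; apply: reach_refl.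
  have [[F0 KF0 F0r]|nF0] :=
      pselect (exists2 F0, K F0 & face_idx F0 = r :> nat); last first.
    have [u Fu uK] := IHr F KF (ltnW rF); exists u => // F' KF'.
    rewrite ltnS leq_eqVlt => /predU1P[F'r|]; last exact: uK.
    by case: nF0; exists F'.
  have [u F0u uK] : exists2 u, face_set F0 u &
      forall F', K F' -> (face_idx F' < r)%N -> face_set F' u.
    by apply: IHr; rewrite ?F0r.
  have [v [F0v Fv]] : face_set F0 `&` face_set F !=set0.
    have [/face_leP[]//|/face_leP[]] := chK F0 F KF0 KF.
    by rewrite F0r leqNgt rF.
  (* [w] keeps the faces of [u] up to index [r] and the face [F] of [v]. *)
  have [w [uw wv]] := reach_between ((face_reach v F0u).1 F0v).
  exists w; first by apply/(face_reach w Fv)/reach_sym/wv; rewrite F0r ltnW.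
  move=> F' KF'; rewrite ltnS leq_eqVlt => /predU1P[F'r|F'r].
    have -> : F' = F0.
      by apply: chain_idx_eq KF' KF0 _ => //; apply: val_inj; rewrite /= F'r.
    by apply/(face_reach w F0u)/uw.
  by apply/(face_reach w (uK F' KF' F'r))/uw; rewrite F0r ltnW.
(* All indices lie below [n.+2]; each stage applies [step] to the member of index [r] itself, if
   there is one. *)
suff /(_ n.+2) [u uK] : forall r, exists u,
    forall F, K F -> (face_idx F < r)%N -> face_set F u.
  by exists u => F KF; apply: uK.
elim=> [|r [u uK]].
  by have [[[u] _] _ _ _ _] := hM; exists u.
have [[F0 KF0 F0r]|nF0] := pselect (exists2 F0, K F0 & face_idx F0 = r :> nat).
  have [w F0w wK] := step r F0 KF0 (eq_leq (esym F0r)).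
  exists w => F KF; rewrite ltnS leq_eqVlt => /predU1P[Fr|]; last exact: wK.
  suff -> : F = F0 by [].
  by apply: chain_idx_eq KF KF0 _ => //; apply: val_inj; rewrite /= Fr.
exists u => F KF; rewrite ltnS leq_eqVlt => /predU1P[Fr|]; last exact: uK.
by case: nF0; exists F.
Qed.

Definition flag_at u : flags facesM := exist _ (flag_of u) (is_flag_flag_of u).

Lemma flag_at_surj (f : flags facesM) : exists u, f = flag_at u.
Proof.
case: f => K [chK maxK]; have [u Ku] := chain_sub_flag_of chK.
have [chu _] := is_flag_flag_of u.
by exists u; apply: eq_exist; rewrite (maxK _ chu Ku).
Qed.

(** * Polytope axioms for the face poset *)

Lemma flagged_faces : flagged facesM n.
Proof.
have [[[u0] conn] _ _ _ _] := hM.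
split.
- exists (face_at ord0 u0) => F; apply/face_leP; split=> //.
  have [v Fv] := face_setP F; exists v; split; last by rewrite Fv; apply: reach_refl.
  by apply: reach_sub (conn u0 v) => c _.
- exists (face_at ord_max u0) => F; apply/face_leP; split; first exact: leq_ord.
  have [v Fv] := face_setP F; exists v; split; first by rewrite Fv; apply: reach_refl.
  apply: reach_sub (conn u0 v) => c _ /=; have := ltn_ord c; rewrite /avoid /=; lia.
- move=> K flK; have [u [->]] := flag_at_surj (exist _ K flK).
  have -> : flag_of u = (fun i => face_at i u : facesM) @` [set: 'I_n.+2].
    apply/seteqP; split=> [F Fu|_ [i _ <-]]; last exact: flag_of_at.
    by exists (face_idx F) => //; rewrite -(face_at_eq Fu).
  apply: card_eq_trans (inj_card_eq _) _; first by move=> i j _ _ [].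
  by rewrite card_eq_sym card_II.
Qed.

Definition face_rank F : int := ((face_idx F)%:Z - 1)%R.

Lemma face_rank_function : rank_function n face_rank.
Proof.
split=> [F1 F2|].
  rewrite lt_neqAle => /andP[/eqP ne12 /face_leP[le12 [u [u1 u2]]]].
  have : (face_idx F1 != face_idx F2 :> nat).
    by apply/eqP => e12; apply: ne12; apply: face_eq u1 u2; apply: val_inj.
  by rewrite /face_rank; lia.
have [[[u0] conn] _ _ _ _] := hM.
apply/seteqP; split=> [_ [F _ <-]|r /= rn].
  by have := ltn_ord (face_idx F); rewrite /face_rank /=; lia.
have rn' : (absz (r + 1)%R < n.+2)%N by lia.
by exists (face_at (Ordinal rn') u0) => //; rewrite /face_rank /=; lia.
Qed.

Definition colour_idx c : 'I_n.+2 := lift ord0 (widen_ord (leqnSn n) c).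

Lemma reach_face_at_eq c u v : reach (avoid c.+1) u v <->
  face_at (colour_idx c) u = face_at (colour_idx c) v.
Proof.
split=> [uv|[]]; last by rewrite /= => ->; apply: reach_refl.
by apply: (@face_eq _ _ v) => //=; apply: reach_refl.
Qed.

(** Vertices of [c]-adjacent flags share every face of rank other than [c], so [reach_bigcap] joins
    them by colour [c] alone. *)
Lemma adjacent_flag_at c u v :
  adjacent face_rank c (flag_at u) (flag_at v) <->
  exists d, [/\ ini d = u, ter d = v & colour d = c].
Proof.
have rk_colour k w : face_rank (face_at (colour_idx k) w) = Posz k.
  by rewrite /face_rank /= /bump /=; lia.
split=> [adj|[d [<- <- dc]] F1 F2 F1u F2v rF].
  have adjk k :=
    adj _ _ (flag_of_at u (colour_idx k)) (flag_of_at v (colour_idx k)) erefl.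
  have /reach_set1[uv|//] : reach [set c] u v.
    apply: reach_bigcap => k ck; apply/reach_face_at_eq; apply: contrapT => ne.
    have := (adjk k).1 ne; rewrite rk_colour => -[/val_inj kc].
    by apply: ck.
  by have := (adjk c).2 (rk_colour c u); rewrite uv.
have e12 : face_idx F1 = face_idx F2.
  by apply: val_inj; move: rF; rewrite /face_rank /=; lia.
have rF1 : face_rank F1 = c <-> face_idx F1 = c.+1 :> nat.
  by rewrite /face_rank; split; lia.
split=> [ne12|/rF1 F1c F12]; last first.
  have [_ [links _] _ _ _] := hM.
  (* If the faces of rank [c] agreed too, all faces would, and the ends of [d] would coincide. *)
  apply: (links d); apply: reach_set0; apply: reach_bigcap => k _.
  have [<-|ne] := eqVneq c k.
    by rewrite -F1c; apply/(face_reach _ F1u); rewrite F12.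
  by apply: reach_dart => -[]; rewrite dc => /val_inj /eqP; rewrite (negbTE ne).
apply/rF1; apply: contrapT => nF1; apply: ne12; apply: face_eq F2v => //.
by apply/(face_reach _ F1u)/reach_dart; rewrite /avoid /= dc => /esym.
Qed.

Lemma faces_diamond : diamond_condition n face_rank.
Proof.
move=> f c; have [u ->] := flag_at_surj f; have [d du dc] := dart_of_colour u c.
exists (flag_at (ter d)); split; first by apply/adjacent_flag_at; exists d.
move=> g; have [v ->] := flag_at_surj g => /adjacent_flag_at [e [eu <- ec]].
have [_ _ _ propY _] := hM.
by congr (flag_at (ter _)); apply: propY; rewrite ?du ?dc.
Qed.

Lemma faces_connected : strongly_flag_connected n face_rank.
Proof.
move=> f g; have [u ->] := flag_at_surj f; have [v ->] := flag_at_surj g.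
(* [K] is fixed before the induction: every flag must contain the faces common to the original
   ends. *)
set K := _ `&` _; have Ku : K `<=` flag_of u by move=> F [].
have : reach [set c | forall F, K F -> face_idx F <> c.+1 :> nat] u v.
  apply: reach_bigcap => k /existsNP[F /not_implyP[[Fu Fv] /contrapT <-]].
  exact/(face_reach _ Fu).
move=> uv; elim/reach_ind: uv Ku => [z Kz|d z dI IH Kd].
  by exists 0, (fun=> flag_at z); split=> // l _.
have [N [s [s0 sN adj Ks]]] : exists (N : nat) (s : nat -> flags facesM),
    [/\ s 0 = flag_at (ter d), s N = flag_at z,
        forall l, (l < N)%N -> exists c, adjacent face_rank c (s l) (s l.+1)
      & forall l, (l <= N)%N -> K `<=` sval (s l)].
  apply: IH => F KF; apply/(face_reach _ (Kd F KF)); apply: reach_dart => /esym.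
  exact: dI.
exists N.+1, (fun l => if l is l'.+1 then s l' else flag_at (ini d)); split=> //.
- case=> [_|l lN]; last exact: adj.
  by exists (colour d); rewrite s0; apply/adjacent_flag_at; exists d.
- by case=> [_|l lN]; last exact: Ks.
Qed.

Definition faces_polytope : polytope n :=
  Polytope flagged_faces face_rank_function faces_diamond faces_connected.

(** * Isomorphism with the flag graph of the faces *)

Lemma flag_at_inj : injective flag_at.
Proof.
move=> u v uv; apply: reach_set0; apply: reach_bigcap => k _.
pose F : facesM := face_at (colour_idx k) u.
have Fv : sval (flag_at v) F by rewrite -uv; apply: flag_of_at.
exact: Fv.
Qed.

Lemma flag_graph_of_faces : cgraph_iso Y (flag_graph faces_polytope).
Proof.
have [_ _ _ propY _] := hM.
have adj d : adjacent face_rank (colour d) (flag_at (ini d)) (flag_at (ter d)).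
  by apply/adjacent_flag_at; exists d.
exists flag_at, (fun d => @FlagDart _ faces_polytope _ _ _ (adj d)); split=> //.
- apply: bijective_inj_surj flag_at_inj _ => f.
  by have [u ->] := flag_at_surj f; exists u.
- apply: bijective_inj_surj => [d e [dc di _]|[c f g fg]].
    by apply: propY dc; apply: flag_at_inj; apply: eq_exist.
  have [u fE] := flag_at_surj f; have [v gE] := flag_at_surj g; subst.
  have [d [du dv dc]] := (adjacent_flag_at c u v).1 fg.
  by exists d; apply: flag_dart_eq; rewrite /= ?du ?dv.
- by move=> d; apply: flag_dart_eq; rewrite /= ?ini_inv ?ter_inv ?colour_inv.
Qed.
End Maniplex.

Theorem theorem4p2 (n : nat) (X : cgraph n) (hX : premaniplex X)
    (G : groupType) (xi : voltage X G) (hM : maniplex (derived xi)) :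
  is_flag_graph_of_polytope (derived xi) <->
  (forall (k m : 'I_n) (x y : X),
     path_volts xi (colours 0 m) x y `&` path_volts xi (colours k n.-1) x y
     = path_volts xi (colours k m) x y).
Proof.
rewrite path_volts_intersection; split=> [[P XP]|hP].
  exact: path_intersection_iso XP (@flag_graph_path_intersection _ P).
by exists (faces_polytope hM hP); apply: flag_graph_of_faces.
Qed.
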